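(* Let $C_{\boldsymbol W}^{\mathfrak n},C_0^{\mathfrak n},C_1^{\mathfrak n}>0$ be constants depending only on $\{N,m_k,d_k,n_k,\boldsymbol W^{\mathfrak n},\boldsymbol\eta^{\mathfrak n}\}$ such that for all $\Delta t>0$, $\varepsilon>0$, $\ell\ge1$ the GST iterates satisfy $\|\Delta^{\ell}\boldsymbol W\|_{\mathrm F}\le C_{\boldsymbol W}^{\mathfrak n}\Gamma_{\boldsymbol W}^{\mathfrak n}\|\Delta^{\ell-1}\boldsymbol\eta\|_2$ and $\|\Delta^{\ell}\boldsymbol\eta\|_2\le (C_0^{\mathfrak n}\Gamma_{\boldsymbol W}^{\mathfrak n}+C_1^{\mathfrak n}\Gamma_{\boldsymbol X}^{\mathfrak n})\|\Delta^{\ell-1}\boldsymbol\eta\|_2$. Given $\Delta t_0>0$, there is a constant $C\in(0,1]$ independent of $\varepsilon$ such that for every $\varepsilon>0$ there exists $\Delta t_1$ with (i) $C\Delta t_0\le\Delta t_1\le\Delta t_0$, and (ii) when $\Gamma_{\boldsymbol W}^{\mathfrak n}$ and $\Gamma_{\boldsymbol X}^{\mathfrak n}$ are evaluated at $\Delta t=\Delta t_1$, $$C_{\boldsymbol W}^{\mathfrak n}\Gamma_{\boldsymbol W}^{\mathfrak n}+C_0^{\mathfrak n}\Gamma_{\boldsymbol W}^{\mathfrak n}+C_1^{\mathfrak n}\Gamma_{\boldsymbol X}^{\mathfrak n}<1,$$ thus ensuring that the GST method with time step $\Delta t=\Delta t_1$ converges (i.e. the sequences $\boldsymbol W^\ell$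 and $\boldsymbol\eta^\ell$ converge as $\ell\to\infty$).
   Context: Setting. $d$ (velocity dimension) and $N$ (number of species) are positive integers, $\varepsilon>0$, $\Delta t>0$. Species $i\in\{1,\dots,N\}$ has mass $m_i>0$, reference diameter $d_i>0$, number density $n_i>0$, mass density $\rho_i=m_in_i$. Given data at the old time level $\mathfrak n$: velocities $\boldsymbol u_i^{\mathfrak n}\in\mathbb R^d$ and temperatures $T_i^{\mathfrak n}>0$. Sums $\sum_j$ run over $j=1,\dots,N$. Collision quantities. For temperatures $T_1,\dots,T_N>0$ put $\Psi_{i,j}=\sqrt{T_i/m_i+T_j/m_j}$ and $\lambda_{i,j}=c_{i,j}n_j\Psi_{i,j}$ with $c_{i,j}=\frac{32\pi^2}{3(2\pi)^{3/2}}\frac{m_im_j}{(m_i+m_j)^2}(d_i+d_j)^2$. Define $A_{i,j}=\frac{\rho_i\rho_j\lambda_{i,j}\lambda_{j,i}}{\rho_i\lambda_{i,j}+\rho_j\lambda_{j,i}}$, $B_{i,j}=\frac{n_in_j\lambda_{i,j}\lambda_{j,i}}{n_i\lambda_{i,j}+n_j\lambda_{j,i}}$, $D_{i,j}=(\sum_kA_{i,k})\delta_{i,j}$, $F_{i,j}=(\sum_kB_{i,k})\delta_{i,j}$. A superscript $\mathfrak n$ or $\ell$ on these quantities means evaluation at the temperatures $T_i^{\mathfrak n}$ or $T_i^{\ell}$. Also $s_i=|\boldsymbol u_i|^2$, $\boldsymbol u_{i,j}=\frac{\rho_i\lambda_{i,j}\boldsymbol u_i+\rho_j\lambda_{j,i}\boldsymbol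 u_j}{\rho_i\lambda_{i,j}+\rho_j\lambda_{j,i}}$ (the common factor $\Psi_{i,j}$ cancels in the weights), $S_{i,j}=|\boldsymbol u_{i,j}|^2$, with superscripts inherited. GST iteration. $\boldsymbol u_i^{0}=\boldsymbol u_i^{\mathfrak n}$, $T_i^{0}=T_i^{\mathfrak n}$, and for $\ell\ge0$ the iterates $\boldsymbol u_i^{\ell+1},T_i^{\ell+1}$ are given by $$\rho_i\frac{\boldsymbol u_i^{\ell+1}-\boldsymbol u_i^{\mathfrak n}}{\Delta t}=\frac1\varepsilon\sum_j(A_{i,j}^{\ell}-D_{i,j}^{\ell})\boldsymbol u_j^{\ell+1},$$ $$\rho_i\frac{s_i^{\ell+1}-s_i^{\mathfrak n}}{\Delta t}+dn_i\frac{T_i^{\ell+1}-T_i^{\mathfrak n}}{\Delta t}=\frac d\varepsilon\sum_j(B_{i,j}^{\ell}-F_{i,j}^{\ell})T_j^{\ell+1}+\frac1\varepsilon\sum_jB_{i,j}^{\ell}\left[m_j(s_j^{\ell+1}-S_{i,j}^{\ell+1})-m_i(s_i^{\ell+1}-S_{i,j}^{\ell+1})\right].$$ Variables. $P=\mathrm{diag}\{\rho_k\}$, $Q=\mathrm{diag}\{n_k\}$; $\boldsymbol U\in\mathbb R^{N\times d}$ has rows $\boldsymbol u_i^\top$, $\boldsymbol T=(T_1,\dots,T_N)^\top$; $\boldsymbol W=P^{1/2}\boldsymbol U$, $\boldsymbol\eta=Q^{1/2}\boldsymbol T$ (with superscripts $\mathfrak n$ or $\ell$). $\Delta^\ell K=K^{\ell+1}-K^\ell$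 for any $\ell$-dependent quantity $K$. $\|\cdot\|_{\mathrm F}$ is the Frobenius norm, $\|\cdot\|_2$ the Euclidean norm. Constants. $A_{\min}^{\mathfrak n}=\min_{i,j}A_{i,j}^{\mathfrak n}$, $B_{\min}^{\mathfrak n}=\min_{i,j}B_{i,j}^{\mathfrak n}$, $\rho_{\max}=\max_k\rho_k$, $n_{\max}=\max_kn_k$, $z_{\min}^{\mathfrak n}=A_{\min}^{\mathfrak n}N/\rho_{\max}$, $\widehat z_{\min}^{\mathfrak n}=B_{\min}^{\mathfrak n}N/n_{\max}$, $\Gamma_{\boldsymbol W}^{\mathfrak n}=\frac{\Delta t\,\varepsilon}{(\varepsilon+\Delta t z_{\min}^{\mathfrak n})^2}$, $\Gamma_{\boldsymbol\eta}^{\mathfrak n}=\frac{\Delta t\,\varepsilon}{(\varepsilon+\Delta t\widehat z_{\min}^{\mathfrak n})^2}$, $\Gamma_{\boldsymbol X}^{\mathfrak n}=\max\{\Gamma_{\boldsymbol W}^{\mathfrak n},\Gamma_{\boldsymbol\eta}^{\mathfrak n}\}$. *)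

(* Defs.v *)
From mathcomp Require Import all_boot all_order all_algebra.
From mathcomp Require Import all_classical all_reals all_analysis.

Set Implicit Arguments.
Unset Strict Implicit.
Unset Printing Implicit Defensive.

Import Order.TTheory GRing.Theory Num.Theory.
Import numFieldNormedType.Exports.

Local Open Scope classical_set_scope.
Local Open Scope ring_scope.

Section Norms.
Context {R : realType}.

Definition norm2 p (v : 'cV[R]_p) : R := Num.sqrt (\sum_i v i 0 ^+ 2).

Definition normF p q (M : 'M[R]_(p, q)) : R :=
  Num.sqrt (\sum_i \sum_j M i j ^+ 2).

(* The index set is finite and, for 0 < N, nonempty, so this infimum is the
   minimum of the entries; likewise for the supremum in [maxI]. *)
Definition min_entry N (M : 'M[R]_N) : R :=
  inf (range (fun ij : 'I_N * 'I_N => M ij.1 ij.2)).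

Definition maxI N (f : 'I_N -> R) : R := sup (range f).

End Norms.

Definition Delta {V : zmodType} (K : nat -> V) (l : nat) : V := K l.+1 - K l.

(* Species i has mass [m i], reference diameter [dia i] and number density
   [n i]; a velocity state is the N x d matrix U whose i-th row is the transpose
   of u_i, and a temperature state is the column vector T. *)
Section GST.
Context {R : realType} {N d : nat}.
Variables (m dia n : 'I_N -> R).
Implicit Types (U : 'M[R]_(N, d)) (T : 'cV[R]_N) (i j k : 'I_N).

Definition rho i : R := m i * n i.

Definition coll i j : R :=
  (32 * pi ^+ 2) / (3 * (2 * pi) `^ (3 / 2))
  * ((m i * m j) / (m i + m j) ^+ 2) * (dia i + dia j) ^+ 2.

Definition Psi T i j : R := Num.sqrt (T i 0 / m i + T j 0 / m j).

Definition lambda T i j : R := coll i j * n j * Psi T i j.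

Definition A T : 'M[R]_N := \matrix_(i, j)
  ((rho i * rho j * lambda T i j * lambda T j i)
   / (rho i * lambda T i j + rho j * lambda T j i)).

Definition B T : 'M[R]_N := \matrix_(i, j)
  ((n i * n j * lambda T i j * lambda T j i)
   / (n i * lambda T i j + n j * lambda T j i)).

Definition D T : 'M[R]_N := diag_mx (\row_i \sum_k A T i k).

Definition F T : 'M[R]_N := diag_mx (\row_i \sum_k B T i k).

Definition vel U i : 'cV[R]_d := (row i U)^T.

Definition s U i : R := norm2 (vel U i) ^+ 2.

Definition u_mix U T i j : 'cV[R]_d :=
  (rho i * lambda T i j + rho j * lambda T j i)^-1 *:
  ((rho i * lambda T i j) *: vel U i + (rho j * lambda T j i) *: vel U j).

Definition S_mix U T i j : R := norm2 (u_mix U T i j) ^+ 2.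

(* (Un, Tn) is the state at the old time level, (U, T) the iterate l and
   (U', T') the iterate l + 1.  The equations do not involve U: the iterate l
   enters only through the matrices evaluated at T. *)
Definition gst_velocity_eq (dt eps : R) (Un : 'M[R]_(N, d)) T U' : Prop :=
  forall i,
    rho i *: (dt^-1 *: (vel U' i - vel Un i))
    = eps^-1 *: \sum_j (A T i j - D T i j) *: vel U' j.

Definition gst_temperature_eq (dt eps : R) (Un : 'M[R]_(N, d)) (Tn : 'cV[R]_N)
    T U' T' : Prop :=
  forall i,
    rho i * ((s U' i - s Un i) / dt) + d%:R * n i * ((T' i 0 - Tn i 0) / dt)
    = d%:R / eps * \sum_j (B T i j - F T i j) * T' j 0
      + eps^-1 * \sum_j B T i j *
          (m j * (s U' j - S_mix U' T' i j)
           - m i * (s U' i - S_mix U' T' i j)).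

(* All collision quantities are evaluated at positive temperatures only; in
   particular S_mix U' T' then has a nonzero denominator, and the common factor
   Psi cancels in its weights. *)
Definition is_gst (dt eps : R) (Un : 'M[R]_(N, d)) (Tn : 'cV[R]_N)
    (U : nat -> 'M[R]_(N, d)) (T : nat -> 'cV[R]_N) : Prop :=
  [/\ U 0%N = Un,
      T 0%N = Tn,
      forall l i, 0 < T l i 0,
      forall l, gst_velocity_eq dt eps Un (T l) (U l.+1)
    & forall l, gst_temperature_eq dt eps Un Tn (T l) (U l.+1) (T l.+1)].

Definition W U : 'M[R]_(N, d) := diag_mx (\row_k Num.sqrt (rho k)) *m U.

Definition eta T : 'cV[R]_N := diag_mx (\row_k Num.sqrt (n k)) *m T.

Definition zmin_W (Tn : 'cV[R]_N) : R := min_entry (A Tn) * N%:R / maxI rho.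

Definition zmin_eta (Tn : 'cV[R]_N) : R := min_entry (B Tn) * N%:R / maxI n.

Definition Gamma_W (Tn : 'cV[R]_N) (dt eps : R) : R :=
  (dt * eps) / (eps + dt * zmin_W Tn) ^+ 2.

Definition Gamma_eta (Tn : 'cV[R]_N) (dt eps : R) : R :=
  (dt * eps) / (eps + dt * zmin_eta Tn) ^+ 2.

Definition Gamma_X (Tn : 'cV[R]_N) (dt eps : R) : R :=
  Num.max (Gamma_W Tn dt eps) (Gamma_eta Tn dt eps).

End GST.

(* Main.v *)
Require Import Defs.
From mathcomp Require Import all_boot all_order all_algebra.
From mathcomp Require Import all_classical all_reals all_analysis.
From mathcomp Require Import ring lra.

Set Implicit Arguments.
Unset Strict Implicit.
Unset Printing Implicit Defensive.

Import Order.TTheory GRing.Theory Num.Theory.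
Import numFieldNormedType.Exports.

Local Open Scope classical_set_scope.
Local Open Scope ring_scope.

(** Both Gamma_W and Gamma_eta have the form dt * eps / (eps + dt * z) ^+ 2 with
    a rate z > 0 that does not depend on dt or eps, so both are at most the
    value kappa of this expression at the smaller rate, and the left-hand side
    of the contraction condition is at most K * kappa with K = CW + C0 + C1.
    Since (eps + dt * z) ^+ 2 exceeds both eps ^+ 2 and (dt * z) ^+ 2, one has
    K * kappa < 1 as soon as dt is small (K * dt <= eps) or large
    (K * eps <= z ^+ 2 * dt) compared with eps.  The largest small
    step is eps / K and the smallest large step is K * eps / z ^+ 2; their ratio
    (z / K) ^+ 2 does not depend on eps.  Hence, if dt0 is not large, shrinking
    it by the factor C = min 1 ((z / K) ^+ 2) makes it small, whatever eps is
    ([step_size_exists]).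

    At such a step, eta contracts with a factor q < 1, so its increments, and
    with them those of W, decay like q ^+ l.  Every matrix entry is then the sum
    of an absolutely convergent telescoping series
    ([cvgn_mx_geometric_increments]). *)

(** * Sequences with geometrically decaying increments *)

Lemma cvgn_geometric_increments (R : realType) (u : nat -> R) (c q : R) :
  0 <= q < 1 -> (forall k, `|u k.+1 - u k| <= c * q ^+ k) -> cvgn u.
Proof.
move=> /andP[q0 q1] uq.
have c0 : 0 <= c by have := uq 0%N; rewrite expr0 mulr1; exact: le_trans.
have cvs : cvgn (series (telescope u)).
  apply: normed_cvg.
  apply: (@series_le_cvg _ _ (geometric c q)) => //=.
  - by move=> k; rewrite mulr_ge0// exprn_ge0.
  - by apply: is_cvg_geometric_series; rewrite ger0_norm.
have -> : u = (fun=> u 0%N) \+ series (telescope u).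
  by apply/funext => k; rewrite {1}eq_sum_telescope.
by apply: is_cvgD => //; exact: is_cvg_cst.
Qed.

Lemma cvgn_mx_entries (R : realType) (p r : nat) (M : nat -> 'M[R]_(p, r)) :
  (forall i j, cvgn (fun k => M k i j)) -> cvgn M.
Proof.
move=> cM; apply/cvg_ex.
exists (\matrix_(i, j) limn (fun k => M k i j)).
apply/cvg_mx_entourageP => E entE.
rewrite near_map; apply: filter_forall => i; apply: filter_forall => j.
have /cvg_entourageP/(_ _ entE) := cM i j; rewrite near_map.
by apply: filterS => k; rewrite mxE inE.
Qed.

Lemma norm_entry_le_normF (R : realType) (p r : nat) (M : 'M[R]_(p, r)) i j :
  `|M i j| <= normF M.
Proof.
rewrite -sqrtr_sqr ler_wsqrtr// (bigD1 i)//= (bigD1 j)//= -addrA lerDl.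
by rewrite addr_ge0 ?sumr_ge0// => *; rewrite ?sumr_ge0// => *; rewrite sqr_ge0.
Qed.

Lemma normF_cV (R : realType) (p : nat) (v : 'cV[R]_p) : normF v = norm2 v.
Proof. by rewrite /normF; under eq_bigr do rewrite big_ord1. Qed.

(** The increments are controlled from index 1 on only: each increment of W is
    bounded by the preceding increment of eta, and the first has none. *)
Lemma cvgn_mx_geometric_increments (R : realType) (p r : nat)
    (M : nat -> 'M[R]_(p, r)) (c q : R) :
  0 <= q < 1 -> (forall k, normF (Delta M k.+1) <= c * q ^+ k) -> cvgn M.
Proof.
move=> q01 Mq; apply: cvgn_mx_entries => i j.
suff : cvgn (fun k => M k.+1 i j).
  by move/cvg_ex => [l Ml]; apply/cvg_ex; exists l; rewrite -cvg_shiftS.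
apply: (@cvgn_geometric_increments _ _ c q) => // k.
apply: le_trans (Mq k); have := norm_entry_le_normF (Delta M k.+1) i j.
by rewrite !mxE.
Qed.

Lemma geometric_decay (R : realType) (x : nat -> R) (q : R) :
  0 <= q -> (forall k, x k.+1 <= q * x k) -> forall k, x k <= x 0%N * q ^+ k.
Proof.
move=> q0 xq; elim=> [|k IH]; first by rewrite expr0 mulr1.
by apply: le_trans (xq k) _; rewrite exprS mulrCA ler_wpM2l.
Qed.

(** * Choice of the time step *)

(** Gamma_W and Gamma_eta are this function at the rates zmin_W and zmin_eta. *)
Definition kappa (R : realType) (z dt eps : R) : R :=
  (dt * eps) / (eps + dt * z) ^+ 2.

Lemma kappa_gt0 (R : realType) (z dt eps : R) :
  0 < z -> 0 < dt -> 0 < eps -> 0 < kappa z dt eps.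
Proof.
by move=> z0 dt0 e0; rewrite divr_gt0 ?exprn_gt0 ?addr_gt0 ?mulr_gt0.
Qed.

Lemma kappa_anti (R : realType) (z z' dt eps : R) :
  0 < z -> z <= z' -> 0 < dt -> 0 < eps -> kappa z' dt eps <= kappa z dt eps.
Proof.
move=> z0 zz' dt0 e0; have z'0 := lt_le_trans z0 zz'.
have h : 0 < eps + dt * z by rewrite addr_gt0// mulr_gt0.
have h' : 0 < eps + dt * z' by rewrite addr_gt0// mulr_gt0.
rewrite ler_pM2l ?mulr_gt0// lef_pV2 ?posrE ?exprn_gt0//.
by rewrite ler_pXn2r ?nnegrE ?(ltW h) ?(ltW h')// lerD2l ler_pM2l.
Qed.

(** Expanding the square in the denominator of kappa, the first condition makes
    the term eps ^+ 2 dominate K * dt * eps, and the second one the term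
    (dt * z) ^+ 2; the cross term provides the strictness. *)
Lemma mul_kappa_lt1 (R : realType) (K z dt eps : R) :
  0 < z -> 0 < dt -> 0 < eps ->
  (K * dt <= eps) || (K * eps <= z ^+ 2 * dt) -> K * kappa z dt eps < 1.
Proof.
move=> z0 dt0 e0 small_or_large.
have h : 0 < eps + dt * z by rewrite addr_gt0// mulr_gt0.
rewrite mulrA ltr_pdivrMr ?exprn_gt0// mul1r sqrrD.
have edz : 0 < eps * (dt * z) by rewrite !mulr_gt0.
have e2 := exprn_gt0 2 e0.
have dz2 : 0 < (dt * z) ^+ 2 by rewrite exprn_gt0 ?mulr_gt0.
case/orP: small_or_large => le_.
- have : K * dt * eps <= eps ^+ 2 by rewrite expr2 ler_pM2r.
  by lra.
- have : K * eps * dt <= (dt * z) ^+ 2.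
    have -> : (dt * z) ^+ 2 = z ^+ 2 * dt * dt by ring.
    by rewrite ler_pM2r.
  by lra.
Qed.

Lemma step_size_exists (R : realType) (K z dt0 : R) :
  0 < K -> 0 < z -> 0 < dt0 ->
  exists C : R, (0 < C <= 1) /\ forall eps, 0 < eps ->
    exists dt1, C * dt0 <= dt1 <= dt0 /\ K * kappa z dt1 eps < 1.
Proof.
move=> K0 z0 dt00; pose C := Num.min 1 ((z / K) ^+ 2); exists C.
have C0 : 0 < C by rewrite lt_min ltr01 exprn_gt0 ?divr_gt0.
have C1 : C <= 1 by rewrite ge_min lexx.
split=> [|eps e0]; first by rewrite C0.
have Cdt0 : C * dt0 <= dt0 by rewrite ger_pMl.
have [large|notlarge] := leP (K * eps) (z ^+ 2 * dt0).
- by exists dt0; rewrite Cdt0 lexx mul_kappa_lt1// large orbT.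
- exists (C * dt0); rewrite lexx Cdt0 mul_kappa_lt1 ?mulr_gt0//.
  apply/orP; left; rewrite -(ler_pM2l K0) ltW//; apply: le_lt_trans notlarge.
  rewrite !mulrA -expr2 ler_pM2r// mulrC -ler_pdivlMr ?exprn_gt0//.
  by rewrite -expr_div_n ge_min lexx orbT.
Qed.

(** * Positivity of the rates *)

Lemma min_entry_gt0 (R : realType) (N : nat) (M : 'M[R]_N) :
  (0 < N)%N -> (forall i j, 0 < M i j) -> 0 < min_entry M.
Proof.
move=> N0 M0; pose i0 := Ordinal N0.
case: (@arg_minP _ _ _ (i0, i0) xpredT (fun ij => M ij.1 ij.2)) => // ij _ minM.
apply: (lt_le_trans (M0 ij.1 ij.2)); apply: lb_le_inf.
- by exists (M i0 i0), (i0, i0).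
- by move=> _ [kl _ <-]; exact: minM.
Qed.

Lemma maxI_gt0 (R : realType) (N : nat) (f : 'I_N -> R) :
  (0 < N)%N -> (forall i, 0 < f i) -> 0 < maxI f.
Proof.
move=> N0 f0; pose i0 := Ordinal N0.
apply: (lt_le_trans (f0 i0)); apply: ub_le_sup; last by exists i0.
case: (@arg_maxP _ _ _ i0 xpredT f) => // i _ maxf.
by exists (f i) => _ [k _ <-]; exact: maxf.
Qed.

Lemma weighted_harmonic_gt0 (R : realFieldType) (a b x y : R) :
  0 < a -> 0 < b -> 0 < x -> 0 < y -> 0 < (a * b * x * y) / (a * x + b * y).
Proof. by move=> *; rewrite divr_gt0 ?addr_gt0 ?mulr_gt0. Qed.

Section Rates.
Context {R : realType} {N : nat} (m dia n : 'I_N -> R) (T : 'cV[R]_N).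
Hypothesis N_gt0 : (0 < N)%N.
Hypothesis m_gt0 : forall i, 0 < m i.
Hypothesis dia_gt0 : forall i, 0 < dia i.
Hypothesis n_gt0 : forall i, 0 < n i.
Hypothesis T_gt0 : forall i, 0 < T i 0.

Lemma rho_gt0 i : 0 < rho m n i.
Proof. by rewrite mulr_gt0. Qed.

Lemma coll_gt0 i j : 0 < coll m dia i j.
Proof.
(* Generalizing over pi keeps the sign lemmas from unfolding it. *)
rewrite /coll; move: (pi : R) (pi_gt0 R) => x x0.
have pow0 : 0 < (2 * x) `^ (3 / 2) by rewrite powR_gt0 // mulr_gt0.
have a0 : 0 < 32 * x ^+ 2 / (3 * (2 * x) `^ (3 / 2)).
  by rewrite divr_gt0 ?mulr_gt0 ?exprn_gt0.
have b0 : 0 < m i * m j / (m i + m j) ^+ 2.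
  by rewrite divr_gt0 ?mulr_gt0 ?exprn_gt0 ?addr_gt0.
by rewrite (mulr_gt0 (mulr_gt0 a0 b0)) ?exprn_gt0 ?addr_gt0.
Qed.

Lemma lambda_gt0 i j : 0 < lambda m dia n T i j.
Proof.
have Psi0 : 0 < Psi m T i j by rewrite sqrtr_gt0 addr_gt0 ?divr_gt0.
by rewrite (mulr_gt0 (mulr_gt0 (coll_gt0 i j) (n_gt0 j))).
Qed.

Lemma A_gt0 i j : 0 < A m dia n T i j.
Proof. by rewrite mxE weighted_harmonic_gt0 ?rho_gt0 ?lambda_gt0. Qed.

Lemma B_gt0 i j : 0 < B m dia n T i j.
Proof. by rewrite mxE weighted_harmonic_gt0 ?lambda_gt0. Qed.

Lemma zmin_W_gt0 : 0 < zmin_W m dia n T.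
Proof.
rewrite divr_gt0 ?mulr_gt0 ?ltr0n//.
- by apply: min_entry_gt0 => //; exact: A_gt0.
- by apply: maxI_gt0 => //; exact: rho_gt0.
Qed.

Lemma zmin_eta_gt0 : 0 < zmin_eta m dia n T.
Proof.
rewrite divr_gt0 ?mulr_gt0 ?ltr0n//; last exact: maxI_gt0.
by apply: min_entry_gt0 => //; exact: B_gt0.
Qed.

End Rates.

(** * Step size and convergence *)

Theorem corollary3p6p1 (R : realType) (N d : nat)
    (N_gt0 : (0 < N)%N) (d_gt0 : (0 < d)%N)
    (m dia n : 'I_N -> R)
    (m_gt0 : forall i, 0 < m i)
    (dia_gt0 : forall i, 0 < dia i)
    (n_gt0 : forall i, 0 < n i)
    (Un : 'M[R]_(N, d)) (Tn : 'cV[R]_N)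
    (Tn_gt0 : forall i, 0 < Tn i 0)
    (CW C0 C1 : R) (CW_gt0 : 0 < CW) (C0_gt0 : 0 < C0) (C1_gt0 : 0 < C1)
    (bound_W : forall dt eps : R, 0 < dt -> 0 < eps ->
       forall (U : nat -> 'M[R]_(N, d)) (T : nat -> 'cV[R]_N),
       is_gst m dia n dt eps Un Tn U T ->
       forall l : nat, (1 <= l)%N ->
       normF (Delta (fun k => W m n (U k)) l)
       <= CW * Gamma_W m dia n Tn dt eps
          * norm2 (Delta (fun k => eta n (T k)) l.-1))
    (bound_eta : forall dt eps : R, 0 < dt -> 0 < eps ->
       forall (U : nat -> 'M[R]_(N, d)) (T : nat -> 'cV[R]_N),
       is_gst m dia n dt eps Un Tn U T ->
       forall l : nat, (1 <= l)%N ->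
       norm2 (Delta (fun k => eta n (T k)) l)
       <= (C0 * Gamma_W m dia n Tn dt eps + C1 * Gamma_X m dia n Tn dt eps)
          * norm2 (Delta (fun k => eta n (T k)) l.-1))
    (dt0 : R) (dt0_gt0 : 0 < dt0) :
  exists C : R, (0 < C <= 1) /\
    forall eps : R, 0 < eps ->
    exists dt1 : R,
      [/\ C * dt0 <= dt1 <= dt0,
          CW * Gamma_W m dia n Tn dt1 eps + C0 * Gamma_W m dia n Tn dt1 eps
            + C1 * Gamma_X m dia n Tn dt1 eps < 1
        & forall (U : nat -> 'M[R]_(N, d)) (T : nat -> 'cV[R]_N),
            is_gst m dia n dt1 eps Un Tn U T ->
            cvgn (fun l => W m n (U l)) /\ cvgn (fun l => eta n (T l))].
Proof.
set zW := zmin_W m dia n Tn; set zE := zmin_eta m dia n Tn.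
have zW0 : 0 < zW by exact: zmin_W_gt0.
have zE0 : 0 < zE by exact: zmin_eta_gt0.
pose z := Num.min zW zE; have z0 : 0 < z by rewrite lt_min zW0.
have K0 : 0 < CW + C0 + C1 by rewrite !addr_gt0.
have [C [C01 step]] := @step_size_exists _ _ _ _ K0 z0 dt0_gt0.
exists C; split=> // eps e0.
have [dt1 [dt1_range small]] := step eps e0.
have dt1_gt0 : 0 < dt1.
  case/andP: dt1_range C01 => + _ /andP[C_gt0 _].
  by apply: lt_le_trans; rewrite mulr_gt0.
set GW := Gamma_W m dia n Tn dt1 eps; set GX := Gamma_X m dia n Tn dt1 eps.
have GW0 : 0 < GW by exact: kappa_gt0.
have GX0 : 0 < GX by rewrite lt_max GW0.
have GW_le : GW <= kappa z dt1 eps by apply: kappa_anti => //; rewrite ge_min lexx.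
have GX_le : GX <= kappa z dt1 eps.
  by rewrite ge_max GW_le; apply: kappa_anti => //; rewrite ge_min lexx orbT.
have contr : CW * GW + C0 * GW + C1 * GX < 1.
  apply: le_lt_trans small; rewrite !mulrDl.
  by rewrite !lerD// ler_pM2l.
exists dt1; split=> // U T UT.
pose q := C0 * GW + C1 * GX.
have q0 : 0 <= q by apply: addr_ge0; rewrite mulr_ge0 // ltW.
have q01 : 0 <= q < 1.
  rewrite q0; apply: (le_lt_trans _ contr).
  by rewrite -addrA lerDr mulr_ge0 // ltW.
pose dE k := norm2 (Delta (fun k => eta n (T k)) k).
have dE_le k : dE k <= dE 0%N * q ^+ k.
  by apply: geometric_decay => // l; exact: (bound_eta _ _ dt1_gt0 e0 _ _ UT l.+1).
split.
- apply: (@cvgn_mx_geometric_increments _ _ _ _ (CW * GW * dE 0%N) q) => // k.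
  apply: le_trans (bound_W _ _ dt1_gt0 e0 _ _ UT k.+1 isT) _.
  by rewrite -[leRHS]mulrA ler_pM2l ?(mulr_gt0 CW_gt0 GW0)//; exact: dE_le.
- apply: (@cvgn_mx_geometric_increments _ _ _ _ (dE 0%N * q) q) => // k.
  by rewrite normF_cV -mulrA -exprS; exact: dE_le.
Qed.
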